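(* Let $(A,\mu,\alpha,\beta)$ be a BiHom-associative algebra and let $\lambda,\gamma\in K$; assume $(A,\mu,\alpha,\beta)$ is unitary with unit $1$ whenever $(\lambda,\gamma)\neq(0,0)$. Let $\psi,\omega:A\to A$ be linear maps such that $\psi(ab)=\psi(a)\psi(b)$ and $\omega(ab)=\omega(a)\omega(b)$ for all $a,b\in A$, and such that $\alpha,\beta,\psi,\omega$ are bijective and any two of them commute. Assume that $(r,s)$, with $r,s\in A\otimes A$, is an associative BiHom-Yang-Baxter pair of weight $(\lambda,\gamma)$ in $(A,\mu,\alpha,\beta)$ (with respect to $\psi,\omega$) and that $r,s$ are $\alpha,\beta,\psi,\omega$-invariant. Define $R,S:A\to A$ by $$R(a)=\beta^{2}\psi(r^{1})\big(\alpha^{-1}\beta^{-1}(a)\,\alpha\omega(r^{2})\big),\qquad S(a)=\beta^{2}\psi(s^{1})\big(\alpha^{-1}\beta^{-1}(a)\,\alpha\omega(s^{2})\big),$$ and $\xi,\zeta:A\otimes A\to A$ by $$\xi(a\otimes b)=\lambda R(ab),\qquad \zeta(a\otimes b)=\gamma S(ab),$$ for all $a,b\in A$. Then $(A,R,S,\alpha,\beta,\xi,\zeta)$ is a double curved Rota-Baxter BiHom-system.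
   Context: $K$ is a field; all vector spaces, tensor products and linear maps are over $K$. Elements of $A\otimes A$ are written $r=r^{1}\otimes r^{2}$ with summation understood; juxtaposition of maps denotes composition. A BiHom-associative algebra $(A,\mu,\alpha,\beta)$ is a vector space $A$ with linear maps $\mu:A\otimes A\to A$, $\mu(a\otimes b)=ab$, and $\alpha,\beta:A\to A$ with $\alpha\beta=\beta\alpha$, $\alpha(ab)=\alpha(a)\alpha(b)$, $\beta(ab)=\beta(a)\beta(b)$, $\alpha(a)(bc)=(ab)\beta(c)$. It is unitary with unit $1\in A$ if $\alpha(1)=\beta(1)=1$, $a1=\alpha(a)$, $1a=\beta(a)$ for all $a$. For $r,s\in A\otimes A$ define in $A\otimes A\otimes A$: $r_{12}s_{23}=\alpha(r^{1})\otimes r^{2}s^{1}\otimes\beta(s^{2})$, $\;r_{13}s_{12}=\omega(r^{1})s^{1}\otimes\beta(s^{2})\otimes\alpha\psi(r^{2})$, $\;r_{23}s_{13}=\beta\omega(s^{1})\otimes\alpha(r^{1})\otimes r^{2}\psi(s^{2})$, and (when $A$ is unitary) $r_{13}=\omega(r^{1})\otimes 1\otimes\psi(r^{2})$. When two factors come from the same element, independent copies are used. An associative BiHom-Yang-Baxter pair of weight $(\lambda,\gamma)$ is a pair $r,s\in A\otimes A$ with $r_{13}r_{12}-r_{12}r_{23}+s_{23}r_{13}=-\lambda r_{13}$ and $s_{13}r_{12}-s_{12}s_{23}+s_{23}s_{13}=-\gamma s_{13}$ (a right-hand side with zero coefficient is read as $0$). For a linear map $F:A\to A$, $r\in A\otimes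 A$ is $F$-invariant if $(F\otimes F)(r)=r$. A double curved Rota-Baxter BiHom-system $(A,R,S,\alpha,\beta,\xi,\zeta)$ consists of a BiHom-associative algebra $(A,\mu,\alpha,\beta)$ and linear maps $R,S:A\to A$, $\xi,\zeta:A\otimes A\to A$ such that $R$ and $S$ commute with $\alpha$ and $\beta$, and for all $a,b\in A$: $R(a)R(b)=R(R(a)b)+R(aS(b))+\xi(a\otimes b)$ and $S(a)S(b)=S(R(a)b)+S(aS(b))+\zeta(a\otimes b)$. *)

(* Defs.v *)
From HB Require Import structures.
From mathcomp Require Import all_boot all_order all_algebra.
From mathcomp Require Import boolp classical_sets.

Set Implicit Arguments.
Unset Strict Implicit.
Unset Printing Implicit Defensive.

Import GRing.Theory.
Local Open Scope quotient_scope.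
Local Open Scope ring_scope.

Reserved Notation "u ⊗ v" (at level 40, left associativity).

(* MathComp has no tensor product of arbitrary (possibly infinite-dimensional)
   vector spaces.  U ⊗ V is built here as the set of finite formal sums of
   pairs (u, v), i.e. sequences of pairs, modulo the congruence generated by
   commutativity of the sum and the bilinearity relations.  Its universal
   property is tlift_pure, tlift_is_linear and tensor_ext below. *)

Section TensorProduct.
Variables (K : fieldType) (U V : lmodType K).
Implicit Types (s t : seq (U * V)).

Inductive tensor_cong : seq (U * V) -> seq (U * V) -> Prop :=
| TCrefl s : tensor_cong s s
| TCsym s t : tensor_cong s t -> tensor_cong t s
| TCtrans t s s' : tensor_cong s t -> tensor_cong t s' -> tensor_cong s s'
| TCcat s t s' t' :
    tensor_cong s t -> tensor_cong s' t' -> tensor_cong (s ++ s') (t ++ t')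
| TCcomm s t : tensor_cong (s ++ t) (t ++ s)
| TCzero v : tensor_cong [:: (0, v)] [::]
| TCaddl u u' v : tensor_cong [:: (u + u', v)] [:: (u, v); (u', v)]
| TCaddr u v v' : tensor_cong [:: (u, v + v')] [:: (u, v); (u, v')]
| TCscale (a : K) u v : tensor_cong [:: (a *: u, v)] [:: (u, a *: v)].

Definition tensor_rel : rel (seq (U * V)) :=
  fun s t => `[< tensor_cong s t >].

Lemma tensor_rel_refl : reflexive tensor_rel.
Proof. by move=> s; apply/asboolP; constructor. Qed.

Lemma tensor_rel_sym : symmetric tensor_rel.
Proof. by move=> s t; apply/asboolP/asboolP; apply: TCsym. Qed.

Lemma tensor_rel_trans : transitive tensor_rel.
Proof.
by move=> t s s' /asboolP h /asboolP h'; apply/asboolP; apply: TCtrans h h'.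
Qed.

Canonical tensor_equiv :=
  EquivRel tensor_rel tensor_rel_refl tensor_rel_sym tensor_rel_trans.

Definition tensor := {eq_quot tensor_rel}.
HB.instance Definition _ : EqQuotient _ tensor_rel tensor :=
  EqQuotient.on tensor.
HB.instance Definition _ := Choice.on tensor.

Lemma tensor_eqP s t : tensor_cong s t <-> \pi_tensor s = \pi_tensor t.
Proof.
by split=> [h|/eqmodP /asboolP //]; apply/eqmodP/asboolP.
Qed.

Definition scale_formal (a : K) s := [seq (a *: p.1, p.2) | p <- s].

Lemma scale_formal1 s : scale_formal 1 s = s.
Proof. by elim: s => [|[u v] s IHs] //=; rewrite scale1r IHs. Qed.

Lemma scale_formal_cong a s t :
  tensor_cong s t -> tensor_cong (scale_formal a s) (scale_formal a t).
Proof.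
elim=> {s t} [s|s t _ h|t s s' _ h _ h'|s t s' t' _ h _ h'|s t|v|u u' v|u v v'
  |b u v] /=.
- exact: TCrefl.
- exact: TCsym.
- exact: TCtrans h h'.
- by rewrite /scale_formal !map_cat; apply: TCcat.
- by rewrite /scale_formal !map_cat; apply: TCcomm.
- by rewrite scaler0; exact: TCzero.
- by rewrite scalerDr; apply: TCaddl.
- exact: TCaddr.
- by rewrite scalerA mulrC -scalerA; apply: TCscale.
Qed.

Definition tensor_zero : tensor := \pi_tensor [::].
Definition tensor_add (x y : tensor) : tensor := \pi_tensor (repr x ++ repr y).
Definition tensor_scale (a : K) (x : tensor) : tensor :=
  \pi_tensor (scale_formal a (repr x)).

Lemma repr_cong s : tensor_cong (repr (\pi_tensor s)) s.
Proof. by apply/tensor_eqP; rewrite reprK. Qed.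

Lemma tensor_addE s t :
  tensor_add (\pi_tensor s) (\pi_tensor t) = \pi_tensor (s ++ t).
Proof. by apply/tensor_eqP; apply: TCcat; apply: repr_cong. Qed.

Lemma tensor_scaleE a s :
  tensor_scale a (\pi_tensor s) = \pi_tensor (scale_formal a s).
Proof. by apply/tensor_eqP; apply: scale_formal_cong; apply: repr_cong. Qed.

Lemma tensor_addA : associative tensor_add.
Proof.
elim/quotW=> s; elim/quotW=> t; elim/quotW=> s'.
by rewrite (tensor_addE t s') (tensor_addE s t) !tensor_addE catA.
Qed.

Lemma tensor_addC : commutative tensor_add.
Proof.
elim/quotW=> s; elim/quotW=> t; rewrite !tensor_addE.
by apply/tensor_eqP; apply: TCcomm.
Qed.

Lemma tensor_add0 : left_id tensor_zero tensor_add.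
Proof. by elim/quotW=> s; rewrite tensor_addE. Qed.

Lemma tensor_scaleDl x a b :
  tensor_scale (a + b) x = tensor_add (tensor_scale a x) (tensor_scale b x).
Proof.
elim/quotW: x => s; rewrite !tensor_scaleE tensor_addE; apply/tensor_eqP.
elim: s => [|[u v] s IHs] /=; first exact: TCrefl.
rewrite scalerDl.
apply: (@TCtrans (([:: (a *: u, v)] ++ [:: (b *: u, v)])
                 ++ (scale_formal a s ++ scale_formal b s))).
  by apply: (TCcat (TCaddl _ _ _) IHs).
rewrite -!catA; apply: (TCcat (TCrefl [:: (a *: u, v)])).
rewrite -[_ :: scale_formal b s]cat1s !catA.
by apply: TCcat (TCcomm _ _) (TCrefl _).
Qed.

Lemma tensor_addN :
  left_inverse tensor_zero (tensor_scale (-1)) tensor_add.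
Proof.
elim/quotW=> s; rewrite tensor_scaleE tensor_addE; apply/tensor_eqP.
have e : tensor_cong (scale_formal (-1) s ++ s) (scale_formal (-1 + 1) s).
  apply/tensor_eqP; rewrite -tensor_scaleE tensor_scaleDl !tensor_scaleE.
  by rewrite tensor_addE scale_formal1.
apply: TCtrans e _; rewrite addNr.
elim: s => [|[u v] s IHs] /=; first exact: TCrefl.
by rewrite scale0r; apply: (TCcat (TCzero v) IHs).
Qed.

HB.instance Definition _ := GRing.isZmodule.Build tensor
  tensor_addA tensor_addC tensor_add0 tensor_addN.

Lemma tensor_scaleA a b x :
  tensor_scale a (tensor_scale b x) = tensor_scale (a * b) x.
Proof.
elim/quotW: x => s; rewrite (tensor_scaleE b s) !tensor_scaleE; congr (\pi_tensor _).
by elim: s => [|[u v] s IHs] //=; rewrite scalerA IHs.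
Qed.

Lemma tensor_scale1 : left_id 1 tensor_scale.
Proof.
by elim/quotW=> s; rewrite tensor_scaleE scale_formal1.
Qed.

Lemma pi_addE s t : \pi_tensor s + \pi_tensor t = \pi_tensor (s ++ t).
Proof. exact: tensor_addE. Qed.

Lemma tensor_scaleDr : right_distributive tensor_scale +%R.
Proof.
move=> a; elim/quotW=> s; elim/quotW=> t.
by rewrite pi_addE !tensor_scaleE pi_addE /scale_formal map_cat.
Qed.

HB.instance Definition _ := GRing.Zmodule_isLmodule.Build K tensor
  tensor_scaleA tensor_scale1 tensor_scaleDr tensor_scaleDl.

Lemma pi_scaleE a s : a *: \pi_tensor s = \pi_tensor (scale_formal a s).
Proof. exact: tensor_scaleE. Qed.

Definition pure (u : U) (v : V) : tensor := \pi_tensor [:: (u, v)].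

Lemma pure_bilinear : bilinear_for *:%R *:%R pure.
Proof.
split=> [v a u u'|u a v v'] /=; rewrite pi_scaleE pi_addE;
  apply/tensor_eqP; first exact: TCaddl.
apply: TCtrans (TCaddr _ _ _) _.
exact: (TCcat (TCsym (TCscale a u v)) (TCrefl [:: (u, v')])).
Qed.

Section Lift.
Variables (W : lmodType K) (f : U -> V -> W).

(* tlift f t is the sum of the f t^1 t^2 over a decomposition of t as
   t^1 ⊗ t^2 (summation understood).  It depends on the chosen representative
   of t unless f is bilinear. *)
Definition tlift (t : tensor) : W := \sum_(p <- repr t) f p.1 p.2.

Hypothesis fB : bilinear_for *:%R *:%R f.

Lemma bilinDl u u' v : f (u + u') v = f u v + f u' v.
Proof. by have := fB.1 v 1 u u'; rewrite /= !scale1r. Qed.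

Lemma bilinDr u v v' : f u (v + v') = f u v + f u v'.
Proof. by have := fB.2 u 1 v v'; rewrite /= !scale1r. Qed.

Lemma bilin0l v : f 0 v = 0.
Proof. by apply: (addIr (f 0 v)); rewrite -bilinDl !add0r. Qed.

Lemma bilin0r u : f u 0 = 0.
Proof. by apply: (addIr (f u 0)); rewrite -bilinDr !add0r. Qed.

Lemma bilinZl a u v : f (a *: u) v = a *: f u v.
Proof. by have := fB.1 v a u 0; rewrite /= bilin0l !addr0. Qed.

Lemma bilinZr a u v : f u (a *: v) = a *: f u v.
Proof. by have := fB.2 u a v 0; rewrite /= bilin0r !addr0. Qed.

Lemma sum_cong s t :
  tensor_cong s t -> \sum_(p <- s) f p.1 p.2 = \sum_(p <- t) f p.1 p.2.
Proof.
elim=> {s t} [s|s t _ h|t s s' _ h _ h'|s t s' t' _ h _ h'|s t|v|u u' v|u v v'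
  |b u v] //.
- by rewrite h.
- by rewrite !big_cat /= h h'.
- by rewrite !big_cat /= addrC.
- by rewrite big_seq1 big_nil bilin0l.
- by rewrite big_seq1 big_cons big_seq1 bilinDl.
- by rewrite big_seq1 big_cons big_seq1 bilinDr.
- by rewrite !big_seq1 /= bilinZl bilinZr.
Qed.

Lemma tlift_pi s : tlift (\pi_tensor s) = \sum_(p <- s) f p.1 p.2.
Proof. exact/sum_cong/repr_cong. Qed.

Lemma tlift_pure u v : tlift (pure u v) = f u v.
Proof. by rewrite /pure tlift_pi big_seq1. Qed.

Lemma tlift_is_linear : linear tlift.
Proof.
move=> a; elim/quotW=> s; elim/quotW=> t.
rewrite pi_scaleE pi_addE !tlift_pi big_cat /=; congr (_ + _).
by rewrite big_map scaler_sumr; apply: eq_bigr => p _ /=; rewrite bilinZl.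
Qed.

End Lift.

Lemma pure_span (t : tensor) : t = \sum_(p <- repr t) pure p.1 p.2.
Proof.
rewrite -[LHS]reprK; elim: (repr t) => [|[u v] s IHs]; first by rewrite big_nil.
by rewrite big_cons -IHs /pure pi_addE.
Qed.

Lemma tensor_ext (W : lmodType K) (f g : {linear tensor -> W}) :
  (forall u v, f (pure u v) = g (pure u v)) -> f =1 g.
Proof.
move=> fg t; rewrite [t]pure_span !raddf_sum.
by apply: eq_bigr => p _; apply: fg.
Qed.

End TensorProduct.

Arguments tensor {K} (U V)%_type_scope.

Notation "U ⊗ V" := (tensor U V) : type_scope.
Notation "u ⊗ v" := (pure u v) : ring_scope.

Definition commuting (T : Type) (f g : T -> T) : Prop := f \o g =1 g \o f.

Section Inverse.
Variables (T : nmodType) (f : T -> T).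

(* the two-sided inverse of f when f is bijective *)
Definition inverse (y : T) : T := xget 0 [set x | f x = y].

Lemma inverseK : bijective f -> cancel f inverse.
Proof.
move=> bf x; apply: (bij_inj bf).
by rewrite /inverse; case: xgetP => [y _ //|no]; case: (no x).
Qed.

Lemma inverseKV : bijective f -> cancel inverse f.
Proof.
move=> bf y; rewrite /inverse; case: xgetP => [x _ //|no].
by case: bf => g _ gK; case: (no (g y)); apply: gK.
Qed.

End Inverse.

Section BiHom.
Variables (K : fieldType) (A : lmodType K).
Variables (mu : {linear (A ⊗ A)%type -> A}) (alpha beta psi omega : {linear A -> A}).
Implicit Types (a b c : A) (r s : A ⊗ A).

Definition mu_multiplicative (f : A -> A) : Prop :=
  forall a b, f (mu (a ⊗ b)) = mu (f a ⊗ f b).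

Record bihom_associative : Prop := BihomAssociative {
  bihom_comm : commuting alpha beta;
  bihom_alphaM : mu_multiplicative alpha;
  bihom_betaM : mu_multiplicative beta;
  bihom_assoc : forall a b c,
    mu (alpha a ⊗ mu (b ⊗ c)) = mu (mu (a ⊗ b) ⊗ beta c)
}.

Record bihom_unit (one : A) : Prop := BihomUnit {
  alpha_one : alpha one = one;
  beta_one : beta one = one;
  bihom_mul1r : forall a, mu (a ⊗ one) = alpha a;
  bihom_mul1l : forall a, mu (one ⊗ a) = beta a
}.

Definition leg12_23 r s : A ⊗ A ⊗ A :=
  tlift (fun r1 r2 : A => tlift (fun s1 s2 : A =>
    alpha r1 ⊗ mu (r2 ⊗ s1) ⊗ beta s2) s) r.

Definition leg13_12 r s : A ⊗ A ⊗ A :=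
  tlift (fun r1 r2 : A => tlift (fun s1 s2 : A =>
    mu (omega r1 ⊗ s1) ⊗ beta s2 ⊗ alpha (psi r2)) s) r.

Definition leg23_13 r s : A ⊗ A ⊗ A :=
  tlift (fun r1 r2 : A => tlift (fun s1 s2 : A =>
    beta (omega s1) ⊗ alpha r1 ⊗ mu (r2 ⊗ psi s2)) s) r.

Definition leg13 (one : A) r : A ⊗ A ⊗ A :=
  tlift (fun r1 r2 : A => omega r1 ⊗ one ⊗ psi r2) r.

(* When lambda = 0 (resp. gamma = 0) the first (resp. second) right-hand side
   is 0 whatever the element one. *)
Definition bihom_YB_pair (one : A) (lambda gamma : K) r s : Prop :=
  leg13_12 r r - leg12_23 r r + leg23_13 s r = - lambda *: leg13 one r /\
  leg13_12 s r - leg12_23 s s + leg23_13 s s = - gamma *: leg13 one s.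

Definition invariant_under (F : A -> A) r : Prop :=
  tlift (fun r1 r2 : A => F r1 ⊗ F r2) r = r.

Record double_curved_RB_system (R S : A -> A) (xi zeta : A ⊗ A -> A) : Prop :=
  DoubleCurvedRBSystem {
  dcRB_assoc : bihom_associative;
  dcRB_R_linear : linear R;
  dcRB_S_linear : linear S;
  dcRB_xi_linear : linear xi;
  dcRB_zeta_linear : linear zeta;
  dcRB_R_alpha : commuting R alpha;
  dcRB_R_beta : commuting R beta;
  dcRB_S_alpha : commuting S alpha;
  dcRB_S_beta : commuting S beta;
  dcRB_R : forall a b,
    mu (R a ⊗ R b) = R (mu (R a ⊗ b)) + R (mu (a ⊗ S b)) + xi (a ⊗ b);
  dcRB_S : forall a b,
    mu (S a ⊗ S b) = S (mu (R a ⊗ b)) + S (mu (a ⊗ S b)) + zeta (a ⊗ b)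
}.

Definition RB_operator r (a : A) : A :=
  tlift (fun r1 r2 : A =>
    mu (beta (beta (psi r1)) ⊗
        mu (inverse alpha (inverse beta a) ⊗ alpha (omega r2)))) r.

(* the linear map a ⊗ b |-> lambda R(ab) *)
Definition curvature (lambda : K) (R : A -> A) (t : A ⊗ A) : A :=
  lambda *: R (mu t).

End BiHom.

(* Main.v *)
Require Import Defs.
From HB Require Import structures.
From mathcomp Require Import all_boot all_order all_algebra.

Set Implicit Arguments.
Unset Strict Implicit.
Unset Printing Implicit Defensive.

(**
The product [a • b := mu (alpha^-1 a ⊗ beta^-1 b)] is associative in the usual
sense, [alpha, beta, psi, omega] are automorphisms of it, a unit of [mu] is a
unit of it, and [mu (a ⊗ b) = alpha a • beta b] ([untwisting]).  Rewriting
everything in terms of [•] removes most of the twists.  By invariance of [r]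
under [alpha] and [beta], the operator attached to [r] is the sandwich
[R a = psi r1 • a • omega r2] ([RB_operatorE]), so that it commutes with
[alpha] and [beta].

The Rota-Baxter identities are then images of the Yang-Baxter equations under
one linear map from [A ⊗ A ⊗ A] to [A], the triple sandwich
[Phi (x ⊗ y ⊗ z) = psi psi x • a • omega psi y • b • omega omega z].  The powers
of [psi] and [omega] are those for which both factors of [r12 s23] can be
normalised by invariance: the two halves of the middle slot receive
[omega psi], the one for [r] being completed by [psi] in the first slot, the
one for [s] by [omega] in the third.  For any [t] invariant under the four
maps, with operator [T], one finds
- [Phi (t13 r12) = T (R a • b)],
- [Phi (t12 t23) = T a • T b],
- [Phi (s23 t13) = T (a • S b)],
- [Phi t13 = T (a • b)] when there is a unit,
so a single equation in [t, r, s] ([sandwich_Rota_Baxter]) yields the identity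
for [R] with [t = r] and that for [S] with [t = s].  Replacing [a, b] by
[alpha a, beta b] turns [•] back into [mu].
*)

Import GRing.Theory.
Local Open Scope ring_scope.

(** * Evaluating bilinear maps on tensors *)

Section TensorCalculus.
Variables (K : fieldType) (U V W : lmodType K).
Implicit Types t : (U ⊗ V)%type.

Lemma eq_tlift (f g : U -> V -> W) t :
  (forall u v, f u v = g u v) -> tlift f t = tlift g t.
Proof. by move=> fg; apply: eq_bigr => p _; apply: fg. Qed.

Lemma raddf_tlift (W' : lmodType K) (h : {additive W -> W'}) (f : U -> V -> W) t :
  h (tlift f t) = tlift (fun u v => h (f u v)) t.
Proof. exact: raddf_sum. Qed.

Lemma exchange_tlift (U' V' : lmodType K) (f : U -> V -> U' -> V' -> W) t
    (t' : (U' ⊗ V')%type) :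
  tlift (fun u v => tlift (f u v) t') t =
  tlift (fun u' v' => tlift (fun u v => f u v u' v') t) t'.
Proof. exact: exchange_big. Qed.

Lemma tlift_linear_param (f : W -> U -> V -> W) t :
  (forall u v, linear (fun w => f w u v)) -> linear (fun w => tlift (f w) t).
Proof.
move=> fL k x y; rewrite /tlift scaler_sumr -big_split /=.
by apply: eq_bigr => p _; rewrite fL.
Qed.

End TensorCalculus.

Section Invariance.
Variables (K : fieldType).

(** Bilinearity of [f] is what makes the value independent of the decomposition
of the inner tensor. *)
Lemma tlift_tlift (U V W U' V' : lmodType K) (f : U -> V -> W) (h : U' -> V' -> (U ⊗ V)%type)
    (t : (U' ⊗ V')%type) :
  bilinear_for *:%R *:%R f ->
  tlift f (tlift h t) = tlift (fun u v => tlift f (h u v)) t.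
Proof.
move=> fB; pose lf := GRing.isLinear.Build _ _ _ _ (tlift f) (tlift_is_linear fB).
pose F : {linear (U ⊗ V)%type -> W} := HB.pack (tlift f) lf.
exact: (raddf_tlift F).
Qed.

Lemma tlift_invariant (A W : lmodType K) (F : A -> A) (f : A -> A -> W) (t : (A ⊗ A)%type) :
  bilinear_for *:%R *:%R f -> invariant_under F t ->
  tlift (fun x y => f (F x) (F y)) t = tlift f t.
Proof.
move=> fB tF; rewrite -[in RHS]tF tlift_tlift //.
by apply: eq_tlift => x y; rewrite tlift_pure.
Qed.

Lemma invariant_comp (A : lmodType K) (F G : {linear A -> A})
    (t : (A ⊗ A)%type) :
  invariant_under F t -> invariant_under G t -> invariant_under (F \o G) t.
Proof.
move=> tF tG; rewrite /invariant_under -[in RHS]tF.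
apply: (tlift_invariant (f := fun x y => F x ⊗ F y)) => //.
have [pl pr] := @pure_bilinear K A A.
by split=> [v k x y|v k x y] /=; rewrite linearP ?pl ?pr.
Qed.

End Invariance.

(** * Sandwich operators in an associative algebra *)

Section Sandwich.
Variables (K : fieldType) (A : lmodType K) (star : {bilinear A -> A -> A}).
Local Notation "a • b" := (star a b) (at level 40, left associativity).
Implicit Types (f g h F : {linear A -> A}) (t : (A ⊗ A)%type).

Lemma star_tliftl (U V : lmodType K) (f : U -> V -> A) (t : (U ⊗ V)%type) b :
  tlift f t • b = tlift (fun x y => f x y • b) t.
Proof. exact: linear_sumlz. Qed.

Lemma star_tliftr (U V : lmodType K) (f : U -> V -> A) (t : (U ⊗ V)%type) a :
  a • tlift f t = tlift (fun x y => a • f x y) t.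
Proof. exact: linear_sumr. Qed.

Definition sandwich f g t a : A := tlift (fun x y => f x • a • g y) t.

Lemma sandwich_bilinear f g a :
  bilinear_for *:%R *:%R (fun x y => f x • a • g y).
Proof. by split=> [y k x x'|x k y y'] /=; rewrite !linearP ?linearPl. Qed.

Lemma sandwich_linear f g t : linear (sandwich f g t).
Proof.
by apply: tlift_linear_param => x y k a b; rewrite linearP !linearPl.
Qed.

Lemma sandwich_invariant f g F t a :
  invariant_under F t ->
  tlift (fun x y => f (F x) • a • g (F y)) t = sandwich f g t a.
Proof.
exact: (tlift_invariant (f := fun x y => f x • a • g y)) (sandwich_bilinear _ _ _).
Qed.

(** The linear map [x ⊗ y ⊗ z |-> f x • a • g y • b • h z]. *)
Definition sandwich3 f g h a b (t : (A ⊗ A ⊗ A)%type) : A :=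
  tlift (fun xy z => sandwich f g xy a • b • h z) t.

Lemma sandwich3_bilinear f g h a b :
  bilinear_for *:%R *:%R
    (fun xy z => sandwich f g xy a • b • h z).
Proof.
have lin k x y : sandwich f g (k *: x + y) a =
    k *: sandwich f g x a + sandwich f g y a.
  exact: (tlift_is_linear (sandwich_bilinear f g a)).
by split=> [z k x x'|x k z z'] /=; rewrite ?lin ?linearPl // !linearP.
Qed.

Lemma sandwich3_linear f g h a b : linear (sandwich3 f g h a b).
Proof. exact/tlift_is_linear/sandwich3_bilinear. Qed.

HB.instance Definition _ f g h a b :=
  GRing.isLinear.Build K _ _ _ (sandwich3 f g h a b) (sandwich3_linear f g h a b).

Lemma sandwich3_pure f g h a b x y z :
  sandwich3 f g h a b (x ⊗ y ⊗ z) = f x • a • g y • b • h z.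
Proof.
rewrite /sandwich3 tlift_pure; last exact: sandwich3_bilinear.
by rewrite /sandwich tlift_pure //; exact: sandwich_bilinear.
Qed.

Lemma sandwich3_tlift f g h a b (U V : lmodType K) (F : U -> V -> (A ⊗ A ⊗ A)%type)
    (t : (U ⊗ V)%type) :
  sandwich3 f g h a b (tlift F t) = tlift (fun x y => sandwich3 f g h a b (F x y)) t.
Proof. exact/tlift_tlift/sandwich3_bilinear. Qed.

End Sandwich.

(** * Removing the twists *)

Section Untwisting.
Variables (K : fieldType) (A : lmodType K).
Variables (mu : {linear (A ⊗ A)%type -> A}) (alpha beta : {linear A -> A}).
Hypotheses (hA : bihom_associative mu alpha beta).
Hypotheses (alpha_bij : bijective alpha) (beta_bij : bijective beta).

(** In an associative algebra with commuting automorphisms [alpha, beta], the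
product [alpha a • beta b] is BiHom-associative (the Yau twist); when [alpha]
and [beta] are invertible every BiHom-associative product arises so. *)
Lemma untwisting : exists star : {bilinear A -> A -> A},
  associative star /\ forall a b, mu (a ⊗ b) = star (alpha a) (beta b).
Proof.
have [comm alphaM betaM assoc] := hA.
have linv (f : {linear A -> A}) (fB : bijective f) : linear (inverse f).
  exact: (can2_linear (inverseK fB) (inverseKV fB)).
pose m a b := mu (inverse alpha a ⊗ inverse beta b).
have mE a b : mu (a ⊗ b) = m (alpha a) (beta b) by rewrite /m !inverseK.
have mB : bilinear_for *:%R *:%R m.
  have [pl pr] := @pure_bilinear K A A.
  by split=> [b k x y|a k x y] /=; rewrite /m linv // (pl, pr) linearP.
pose bm := bilinear_isBilinear.Build _ _ _ _ _ _ m mB.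
pose star : {bilinear A -> A -> A} := HB.pack m bm.
exists star; split=> // a b c /=.
(* In the form [alpha alpha a, alpha beta b, beta beta c] the three arguments
   make both sides of associativity for [m] values of [mu] on [a, b, c]. *)
rewrite -(inverseKV alpha_bij a) -(inverseKV alpha_bij (inverse alpha a)).
rewrite -(inverseKV alpha_bij b) -(inverseKV beta_bij (inverse alpha b)).
rewrite -(inverseKV beta_bij c) -(inverseKV beta_bij (inverse beta c)).
move: (inverse alpha (inverse _ _)) (inverse beta (inverse alpha _)) => {}a {}b.
move: (inverse beta (inverse _ _)) => {}c.
by rewrite -mE -betaM -mE [alpha (beta b)]comm -mE -alphaM -mE assoc.
Qed.

End Untwisting.

(** * The Yang-Baxter equation as a Rota-Baxter identity *)

Section YangBaxterRotaBaxter.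
Variables (K : fieldType) (A : lmodType K).
Variables (mu : {linear (A ⊗ A)%type -> A}).
Variables (alpha beta psi omega : {linear A -> A}) (star : {bilinear A -> A -> A}).
Local Notation "a • b" := (star a b) (at level 40, left associativity).
Hypotheses (starA : associative star).
Hypotheses (mu_star : forall a b, mu (a ⊗ b) = alpha a • beta b).
Hypotheses (alpha_bij : bijective alpha) (beta_bij : bijective beta).
Hypotheses (alphaM : mu_multiplicative mu alpha) (betaM : mu_multiplicative mu beta).
Hypotheses (psiM : mu_multiplicative mu psi) (omegaM : mu_multiplicative mu omega).
Hypotheses (alpha_beta : commuting alpha beta).
Hypotheses (alpha_psi : commuting alpha psi) (alpha_omega : commuting alpha omega).
Hypotheses (beta_psi : commuting beta psi) (beta_omega : commuting beta omega).
Hypotheses (psi_omega : commuting psi omega).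

Lemma star_multiplicative (f : {linear A -> A}) :
  mu_multiplicative mu f -> commuting alpha f -> commuting beta f ->
  {morph f : a b / a • b}.
Proof.
move=> fM af bf a b.
rewrite -(inverseKV alpha_bij a) -(inverseKV beta_bij b) -mu_star fM mu_star.
by rewrite [alpha (f _)]af [beta (f _)]bf.
Qed.

Let alphaS : {morph alpha : a b / a • b}.
Proof. by apply: star_multiplicative => // x /=; rewrite [alpha _]alpha_beta. Qed.

Let betaS : {morph beta : a b / a • b}.
Proof. exact: star_multiplicative. Qed.

Let psiS : {morph psi : a b / a • b}.
Proof. exact: star_multiplicative. Qed.

Let omegaS : {morph omega : a b / a • b}.
Proof. exact: star_multiplicative. Qed.

(** Oriented so that rewriting terminates: every composite of the four maps gets
the normal form in which [psi] stands outside [omega], [omega] outside [alpha],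
[alpha] outside [beta]. *)
Let push : (forall x, alpha (psi x) = psi (alpha x)) *
  (forall x, alpha (omega x) = omega (alpha x)) *
  (forall x, beta (psi x) = psi (beta x)) *
  (forall x, beta (omega x) = omega (beta x)) *
  (forall x, omega (psi x) = psi (omega x)) *
  (forall x, beta (alpha x) = alpha (beta x)).
Proof.
(do !split) => x; [exact: alpha_psi|exact: alpha_omega|exact: beta_psi
  |exact: beta_omega|exact: esym (psi_omega x)|exact: esym (alpha_beta x)].
Qed.

Definition invariant4 (t : (A ⊗ A)%type) : Prop :=
  [/\ invariant_under alpha t, invariant_under beta t,
      invariant_under psi t & invariant_under omega t].

Local Notation sand := (sandwich star psi omega).

(** Once the product is untwisted, [alpha beta beta] is the only excess twist, and
it acts equally on both legs of [t], so invariance absorbs it. *)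
Lemma RB_operatorE t a : invariant4 t ->
  RB_operator mu alpha beta psi omega t a = sand t a.
Proof.
case=> tA tB _ _.
have tABB := invariant_comp tA (invariant_comp tB tB).
rewrite -(sandwich_invariant _ _ _ _ tABB) /RB_operator.
apply: eq_tlift => x y /=.
by rewrite !mu_star betaS !inverseKV // !push starA.
Qed.

Lemma sandwich_commuting (f : {linear A -> A}) t :
  {morph f : a b / a • b} -> commuting f psi -> commuting f omega ->
  invariant_under f t -> commuting (sand t) f.
Proof.
move=> fS fpsi fomega tf a /=.
rewrite -(sandwich_invariant _ _ _ _ tf) [in RHS]/sandwich raddf_tlift.
by apply: eq_tlift => x y /=; rewrite !fS [f (psi _)]fpsi [f (omega _)]fomega.
Qed.

Local Notation Phi :=
  (sandwich3 star (psi \o psi) (omega \o psi) (omega \o omega)).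

(** In this lemma and in those for the other legs, each copy of an invariant
tensor enters the left-hand side with the same extra automorphism on both of its
legs; the composites given to [invariant_comp] are these automorphisms. *)
Lemma Phi_leg12_23 r s a b : invariant4 r -> invariant4 s ->
  Phi a b (leg12_23 mu alpha beta r s) = sand r a • sand s b.
Proof.
case=> rA rB rP rO [sA sB sP sO].
rewrite -(sandwich_invariant _ _ _ a (invariant_comp rP rA)).
rewrite -(sandwich_invariant _ _ _ b (invariant_comp sO sB)).
rewrite star_tliftl sandwich3_tlift; apply: eq_tlift => x y.
rewrite star_tliftr sandwich3_tlift; apply: eq_tlift => x' y'.
by rewrite sandwich3_pure mu_star /= !(psiS, omegaS) !push !starA.
Qed.

Lemma Phi_leg13_12 t r a b : invariant4 t -> invariant4 r ->
  Phi a b (leg13_12 mu alpha beta psi omega t r) = sand t (sand r a • b).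
Proof.
case=> tA tB tP tO [rA rB rP rO].
rewrite -(sandwich_invariant _ _ _ _ (invariant_comp tP (invariant_comp tO tA))).
rewrite -(sandwich_invariant _ _ _ a (invariant_comp rP rB)).
rewrite sandwich3_tlift; apply: eq_tlift => x y.
rewrite star_tliftl star_tliftr star_tliftl sandwich3_tlift.
apply: eq_tlift => x' y'.
by rewrite sandwich3_pure mu_star /= !(psiS, omegaS) !push !starA.
Qed.

Lemma Phi_leg23_13 s t a b : invariant4 s -> invariant4 t ->
  Phi a b (leg23_13 mu alpha beta psi omega s t) = sand t (a • sand s b).
Proof.
case=> sA sB sP sO [tA tB tP tO].
rewrite -(sandwich_invariant _ _ _ _ (invariant_comp tP (invariant_comp tO tB))).
rewrite -(sandwich_invariant _ _ _ b (invariant_comp sO sA)).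
(* The leg sums over [s] outside, but [sand t] is the outer sandwich. *)
rewrite /leg23_13 exchange_tlift sandwich3_tlift; apply: eq_tlift => x y.
rewrite !star_tliftr star_tliftl sandwich3_tlift; apply: eq_tlift => x' y'.
by rewrite sandwich3_pure mu_star /= !(psiS, omegaS) !push !starA.
Qed.

Hypotheses (psi_bij : bijective psi) (omega_bij : bijective omega).

Lemma unit_fixed (f : {linear A -> A}) one :
  bijective f -> {morph f : a b / a • b} -> left_id one star ->
  right_id one star -> f one = one.
Proof.
move=> fB fS onel oner; rewrite -[LHS]oner -{2}(inverseKV fB one).
by rewrite -fS onel inverseKV.
Qed.

Lemma Phi_leg13 one t a b : bihom_unit mu alpha beta one -> invariant4 t ->
  Phi a b (leg13 psi omega one t) = sand t (a • b).
Proof.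
case=> one_alpha one_beta mul1r mul1l [tA tB tP tO].
have onel : left_id one star.
  by move=> x; rewrite -[x](inverseKV beta_bij) -{1}one_alpha -mu_star.
have oner : right_id one star.
  by move=> x; rewrite -[x](inverseKV alpha_bij) -{1}one_beta -mu_star.
rewrite -(sandwich_invariant _ _ _ _ (invariant_comp tP tO)).
rewrite sandwich3_tlift; apply: eq_tlift => x y.
rewrite sandwich3_pure /= (unit_fixed psi_bij psiS onel oner).
by rewrite (unit_fixed omega_bij omegaS onel oner) oner !push !starA.
Qed.

(** The operator [T] of [t] appears on both sides, while [R] and [S] are only
fed to it: keeping [t] independent of [r] and [s] covers both identities. *)
Lemma sandwich_Rota_Baxter one lambda t r s a b :
  (lambda != 0 -> bihom_unit mu alpha beta one) ->
  invariant4 t -> invariant4 r -> invariant4 s ->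
  leg13_12 mu alpha beta psi omega t r - leg12_23 mu alpha beta t t
    + leg23_13 mu alpha beta psi omega s t = - lambda *: leg13 psi omega one t ->
  sand t a • sand t b = sand t (sand r a • b) + sand t (a • sand s b)
    + lambda *: sand t (a • b).
Proof.
move=> unit ti ri si /(congr1 (Phi a b)).
rewrite linearD linearB linearZ /=.
rewrite Phi_leg13_12 // Phi_leg12_23 // Phi_leg23_13 //.
have -> : - lambda *: Phi a b (leg13 psi omega one t) =
    - (lambda *: sand t (a • b)).
  have [->|lambda_n0] := eqVneq lambda 0; first by rewrite oppr0 !scale0r oppr0.
  by rewrite Phi_leg13 ?scaleNr //; apply: unit.
rewrite addrAC => /eqP; rewrite subr_eq => /eqP ->.
by rewrite addrAC addNr add0r.
Qed.

End YangBaxterRotaBaxter.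

Theorem theorem2p5 (K : fieldType) (A : lmodType K)
    (mu : {linear (A ⊗ A)%type -> A}) (alpha beta psi omega : {linear A -> A})
    (one : A) (lambda gamma : K) (r s : A ⊗ A)
    (hA : bihom_associative mu alpha beta)
    (h1 : (lambda, gamma) <> (0, 0) -> bihom_unit mu alpha beta one)
    (psiM : mu_multiplicative mu psi) (omegaM : mu_multiplicative mu omega)
    (alpha_bij : bijective alpha) (beta_bij : bijective beta)
    (psi_bij : bijective psi) (omega_bij : bijective omega)
    (alpha_beta : commuting alpha beta)
    (alpha_psi : commuting alpha psi) (alpha_omega : commuting alpha omega)
    (beta_psi : commuting beta psi) (beta_omega : commuting beta omega)
    (psi_omega : commuting psi omega)
    (hrs : bihom_YB_pair mu alpha beta psi omega one lambda gamma r s)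
    (r_alpha : invariant_under alpha r) (r_beta : invariant_under beta r)
    (r_psi : invariant_under psi r) (r_omega : invariant_under omega r)
    (s_alpha : invariant_under alpha s) (s_beta : invariant_under beta s)
    (s_psi : invariant_under psi s) (s_omega : invariant_under omega s) :
  let R := RB_operator mu alpha beta psi omega r in
  let S := RB_operator mu alpha beta psi omega s in
  double_curved_RB_system mu alpha beta R S
    (curvature mu lambda R) (curvature mu gamma S).
Proof.
have [star [starA mu_star]] := untwisting hA alpha_bij beta_bij.
have [_ alphaM betaM _] := hA.
have ri : invariant4 alpha beta psi omega r by [].
have si : invariant4 alpha beta psi omega s by [].
move=> R S.
have RE a : R a = sandwich star psi omega r a by exact: RB_operatorE.
have SE a : S a = sandwich star psi omega s a by exact: RB_operatorE.
have [eq_r eq_s] := hrs.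
have alphaS : {morph alpha : a b / star a b}.
  exact: (star_multiplicative (beta := beta)).
have betaS : {morph beta : a b / star a b}.
  exact: (star_multiplicative (alpha := alpha)).
have R_lin : linear R by move=> k a b; rewrite !RE sandwich_linear.
have S_lin : linear S by move=> k a b; rewrite !SE sandwich_linear.
have comm_op T t f : T =1 sandwich star psi omega t ->
    commuting (sandwich star psi omega t) f -> commuting T f.
  by move=> TE tf a; rewrite /= !TE; apply: tf.
have R_alpha : commuting R alpha by apply: comm_op RE _; apply: sandwich_commuting.
have R_beta : commuting R beta by apply: comm_op RE _; apply: sandwich_commuting.
have S_alpha : commuting S alpha by apply: comm_op SE _; apply: sandwich_commuting.
have S_beta : commuting S beta by apply: comm_op SE _; apply: sandwich_commuting.
split=> //.
- by move=> k x y; rewrite /curvature linearP R_lin scalerDr !scalerA mulrC.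
- by move=> k x y; rewrite /curvature linearP S_lin scalerDr !scalerA mulrC.
- move=> a b; rewrite /curvature !mu_star.
  rewrite -[alpha (R a)]R_alpha -[beta (R b)]R_beta -[beta (S b)]S_beta /=.
  rewrite !RE !SE; apply: sandwich_Rota_Baxter eq_r => // lambda_n0.
  by apply: h1 => -[l0 _]; rewrite l0 eqxx in lambda_n0.
- move=> a b; rewrite /curvature !mu_star.
  rewrite -[alpha (R a)]R_alpha -[alpha (S a)]S_alpha.
  rewrite -[beta (S b)]S_beta /=.
  rewrite !RE !SE; apply: sandwich_Rota_Baxter eq_s => // gamma_n0.
  by apply: h1 => -[_ g0]; rewrite g0 eqxx in gamma_n0.
Qed.
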